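(* Let $k$ be a field, let $n\ge 1$ and let $f=(f_1,\ldots,f_n)\in \mathrm{End}(\mathbb{A}^n)$ be a dominant endomorphism of $\mathbb{A}^n=\mathbb{A}^n_k$ with maximal eigenvalue $\theta$. Then the following hold: (1) There exists a maximal eigenvector $\mu=(\mu_1,\ldots,\mu_n)\in (\mathbb{R}_{\ge 0})^n \setminus \{0\}$ of $f$. (2) We have $1\le \lambda(f)\le \theta \le \deg(f)$. (3) For each maximal eigenvector $\mu$ of $f$, we have $\theta=\deg_\mu(f)$, and the following hold: (i) If $f$ is $\mu$-algebraically stable, then $\lambda(f)=\theta$. (ii) If $\lambda(f)=\theta$, $\theta>1$ and $\mu\in (\mathbb{R}_{>0})^n$, then $f$ is $\mu$-algebraically stable. (iii) Let $g \in \mathrm{End}(\mathbb{A}^n)$ be the $\mu$-leading part of $f$. If $\theta > 1$, then $f$ is $\mu$-algebraically stable if and only if for each $r \geq 1$ there is $i \in \{1, \ldots, n\}$ with $\mu_i > 0$ and such that the $i$-th component of $g^r$ is non-zero.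
   Context: An endomorphism of $\mathbb{A}^n=\mathbb{A}^n_k$ is a tuple $f=(f_1,\ldots,f_n)\in k[x_1,\ldots,x_n]^n$, with composition $(f\circ g)_i=f_i(g_1,\ldots,g_n)$; $f^r$ is the $r$-fold iterate. $\deg(f)=\max_i \deg(f_i)$, and for dominant $f$ the dynamical degree is $\lambda(f)=\lim_{r\to\infty}\deg(f^r)^{1/r}$ (the limit exists). For $\mu=(\mu_1,\ldots,\mu_n)\in(\mathbb{R}_{\ge0})^n\setminus\{0\}$, the degree function $\deg_\mu$ on $k[x_1,\ldots,x_n]$ is given by $\deg_\mu(0)=-\infty$ and, for $p\ne0$, $\deg_\mu(p)=\max\{\sum_i a_i\mu_i\}$ over all exponents $(a_1,\ldots,a_n)\in\mathbb{N}^n$ of monomials appearing in $p$ with nonzero coefficient. The $\mu$-homogeneous part of $q$ of degree $\theta$ is the sum of the monomial terms of $q$ of $\mu$-degree $\theta$. For a nonzero $f\in\mathrm{End}(\mathbb{A}^n)$, $\deg_\mu(f)=\inf\{\theta\in\mathbb{R}_{\ge0}\mid \deg_\mu(f_i)\le\theta\mu_i\text{ for all }i\}$, with $\deg_\mu(f)=\infty$ if this set is empty. $f$ is $\mu$-algebraically stable if $\deg_\mu(f)<\infty$ and $\deg_\mu(f^r)=\deg_\mu(f)^r$ for each $r\ge1$. If $f$ is dominant and $\deg_\mu(f)=\theta<\infty$, the $\mu$-leading part of $f$ is $g=(g_1,\ldots,g_n)$, where $g_j$ is the $\mu$-homogeneous part of $f_j$ of degree $\theta\mu_j$. Let $f\in\mathrm{End}(\mathbb{A}^n)$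 with all $f_i\ne0$. A matrix $M=(m_{i,j})\in\mathrm{Mat}_n(\mathbb{N})$ (with $0\in\mathbb{N}$) is contained in $f$ if for each $i$ the coefficient of the monomial $\prod_{j=1}^n x_j^{m_{i,j}}$ in $f_i$ is nonzero; the set of such matrices is finite and non-empty. The maximal eigenvalue of $f$ is $\theta=\max\{|\xi| \mid \xi\text{ is a (complex) eigenvalue of a matrix contained in } f\}$. A maximal eigenvector of $f$ is an element $\mu\in(\mathbb{R}_{\ge0})^n\setminus\{0\}$ with $\deg_\mu(f_i)=\theta\mu_i$ for each $i\in\{1,\ldots,n\}$. *)

(* Defs.v *)
(* MathComp world, with MathComp-Analysis. *)
From HB Require Import structures.
From mathcomp Require Export all_boot all_order all_algebra.
From mathcomp Require Export complex.
From mathcomp Require Export mathcomp_extra boolp classical_sets reals ereal.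
From mathcomp Require Export topology normedtype sequences exp.
From mathcomp Require mpoly.
(* The notations of mpoly do not parse together with those of
   MathComp-Analysis. *)
Export -(notations) mpoly.
Export numFieldNormedType.Exports.

Set Implicit Arguments.
Unset Strict Implicit.
Unset Printing Implicit Defensive.

Import Order.TTheory GRing.Theory Num.Theory.

Local Open Scope classical_set_scope.
Local Open Scope ring_scope.

Notation "{ 'mpoly' k [ n ] }" := (mpoly n k)
  (at level 0, k at level 2, n at level 9, format "{ 'mpoly'  k [ n ] }").

Definition endo (k : fieldType) (n : nat) : Type := n.-tuple {mpoly k[n]}.

Section Endomorphisms.
Variables (k : fieldType) (n : nat).
Implicit Types (f g : endo k n) (p : {mpoly k[n]}).

Definition endo_id : endo k n := [tuple mpolyX k (mnm1 i) | i < n].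

Definition endo_comp f g : endo k n := [tuple comp_mpoly g (tnth f i) | i < n].

Definition endo_iter f (r : nat) : endo k n := iter r (endo_comp f) endo_id.

(* A point of the scheme A^n_k is given by a field extension K of k and a
   vector x in K^n, and f sends it to (f_1(x), ..., f_n(x)). This says that
   the image of f is Zariski dense: the only closed set V(p) that contains the
   image is the whole space, i.e. p = 0. Using points over all extensions K
   matters when k is not algebraically closed, for instance finite. *)
Definition dominant f : Prop :=
  forall p,
    (forall (K : fieldType) (iota : {rmorphism k -> K}) (x : 'I_n -> K),
       mmap iota (fun i => mmap iota x (tnth f i)) p = 0) ->
    p = 0.

(* [mmeasure mdeg p] is 1 + the total degree of p, and 0 if p = 0. A zero
   component gets degree 0 instead of -oo; this does not change the maximum
   unless all the components are zero. *)
Definition endo_deg f : nat := (\max_(i < n) (mmeasure mdeg (tnth f i)).-1)%N.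

Definition contained (M : 'M[nat]_n) f : Prop :=
  forall i, mcoeff (Multinom [tuple M i j | j < n]) (tnth f i) != 0.

End Endomorphisms.

Section Degrees.
Variables (R : realType) (k : fieldType) (n : nat).
Implicit Types (mu : 'rV[R]_n) (f : endo k n) (p q : {mpoly k[n]}).

Definition dynamical_degree f : R :=
  limn (fun r : nat => (endo_deg (endo_iter f r))%:R `^ (r%:R^-1) : R).

Definition mnm_weight mu (m : multinom n) : R := \sum_(i < n) (m i)%:R * mu 0 i.

Definition deg_mu mu p : \bar R :=
  (\big[maxe/-oo]_(m <- msupp p) (mnm_weight mu m)%:E)%E.

Definition endo_deg_mu mu f : \bar R :=
  ereal_inf [set t%:E | t in [set t : R |
    0 <= t /\ forall i, (deg_mu mu (tnth f i) <= (t * mu 0 i)%:E)%E]].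

Definition alg_stable mu f : Prop :=
  (endo_deg_mu mu f < +oo)%E /\
  forall r : nat, (1 <= r)%N ->
    endo_deg_mu mu (endo_iter f r) = (endo_deg_mu mu f ^+ r)%E.

Definition homog_part mu (t : R) q : {mpoly k[n]} :=
  \sum_(m <- msupp q | mnm_weight mu m == t) mcoeff m q *: mpolyX k m.

(* Meaningful when [endo_deg_mu mu f] is finite. *)
Definition leading_part mu f : endo k n :=
  [tuple homog_part mu (fine (endo_deg_mu mu f) * mu 0 j) (tnth f j) | j < n].

Definition eigen_moduli f : set R :=
  [set t : R | exists (M : 'M[nat]_n) (xi : R[i]),
     [/\ contained M f,
         eigenvalue (map_mx (fun a : nat => a%:R : R[i]) M) xi &
         t = ComplexField.Normc.normc xi]].

(* The maximum of [eigen_moduli f], which exists when all the components of f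
   are nonzero and n >= 1. *)
Definition maximal_eigenvalue f : R :=
  get [set t : R | eigen_moduli f t /\ ubound (eigen_moduli f) t].

Definition maximal_eigenvector f mu : Prop :=
  [/\ forall i, 0 <= mu 0 i,
      mu != 0 &
      forall i, deg_mu mu (tnth f i) = (maximal_eigenvalue f * mu 0 i)%:E].

End Degrees.

Arguments dynamical_degree R {k n} f.
Arguments maximal_eigenvalue R {k n} f.

(* Main.v *)
(* The map T(mu)_i = deg_mu(f_i) on nonnegative vectors is the maximum of the
   linear maps given by the matrices contained in f, so it is monotone,
   homogeneous and continuous. Nonlinear Perron-Frobenius theory gives it an
   eigenvector whose eigenvalue s is the infimum of the t with T nu <= t nu for
   some positive nu. Choosing in each row a monomial that realises the maximum
   shows that s is an eigenvalue of a matrix contained in f, while a positive nu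
   with T nu <= t nu bounds by t all eigenvalues of such matrices; so s = theta.
   Such a nu also gives deg(f^r) = O(t^r), hence lambda(f) <= theta. Conversely,
   by Fekete's lemma lambda(f)^r <= deg(f^r) for all r, and for every
   a > lambda(f) one has deg(f^r) = O(a^r). Finally, the mu-homogeneous part of
   degree theta^r mu_i of the i-th component of f^r is the i-th component of
   g^r, where g is the mu-leading part. *)
From mathcomp Require Import derive.
From mathcomp Require Import ring lra.
Require Import Defs.

Set Implicit Arguments.
Unset Strict Implicit.
Unset Printing Implicit Defensive.

Import Order.TTheory GRing.Theory Num.Theory.

Local Open Scope classical_set_scope.
Local Open Scope ring_scope.

(** * Composition, iterates, and injectivity of substitution for dominant maps *)

Section Composition.
Variables (k : fieldType) (n : nat).
Implicit Types (f g h : endo k n) (p q : {mpoly k[n]}).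

Lemma comp_mpolyA f g p : comp_mpoly g (comp_mpoly f p) =
  comp_mpoly (endo_comp f g) p.
Proof.
rewrite (comp_mpolyE p f) (comp_mpolyE p) raddf_sum /=; apply: eq_bigr => m _.
rewrite comp_mpolyZ rmorph_prod; congr (_ *: _).
by apply: eq_bigr => i _; rewrite rmorphXn tnth_mktuple.
Qed.

Lemma endo_iterS f r : endo_iter f r.+1 = endo_comp f (endo_iter f r).
Proof. by []. Qed.

Lemma endo_iter_comp f r i :
  tnth (endo_iter f r.+1) i = comp_mpoly (endo_iter f r) (tnth f i).
Proof. by rewrite endo_iterS tnth_mktuple. Qed.

Lemma endo_iterD f r s i :
  tnth (endo_iter f (r + s)) i = comp_mpoly (endo_iter f s) (tnth (endo_iter f r) i).
Proof.
elim: r i => [|r IH] i.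
  by rewrite add0n tnth_mktuple comp_mpolyXU -tnth_nth.
rewrite addSn !endo_iter_comp comp_mpolyA; congr (comp_mpoly _ _).
by apply: eq_from_tnth => j; rewrite tnth_mktuple IH.
Qed.

(** Evaluating the composite at a point x over any extension is evaluating p at the image of x, so p
    vanishes on the whole image of f. *)
Lemma dominant_comp_inj f p : dominant f -> comp_mpoly f p = 0 -> p = 0.
Proof.
move=> hf hp; apply: hf => K iota x.
have -> : mmap iota (fun i => mmap iota x (tnth f i)) p =
          mmap iota x (comp_mpoly f p); last by rewrite hp raddf0.
rewrite (comp_mpolyE p) raddf_sum /= {1}/mmap; apply: eq_bigr => m _.
rewrite mmapZ rmorph_prod; congr (_ * _); apply: eq_bigr => i _.
by rewrite rmorphXn.
Qed.

Lemma dominant_iter_inj f r p :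
  dominant f -> comp_mpoly (endo_iter f r) p = 0 -> p = 0.
Proof.
move=> hf; elim: r p => [|r IH] p; first by rewrite comp_mpoly_id.
by rewrite endo_iterS -comp_mpolyA => /IH /(dominant_comp_inj hf).
Qed.

(** Otherwise substituting [f^r] would annihilate the nonzero polynomial [x_i - c]. *)
Lemma dominant_iter_neqC f r i c : dominant f -> tnth (endo_iter f r) i <> mpolyC _ c.
Proof.
move=> hf fc.
have /(dominant_iter_inj hf (r := r)) /eqP :
  comp_mpoly (endo_iter f r) (mpolyX k (mnm1 i) - mpolyC _ c) = 0.
  by rewrite comp_mpolyB comp_mpolyC comp_mpolyXU -tnth_nth fc subrr.
rewrite subr_eq0 => /eqP /(congr1 (mcoeff (mnm1 i))).
rewrite mcoeffX mcoeffC eqxx mnm1_eq0 mulr0 => /eqP.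
by rewrite oner_eq0.
Qed.

Lemma dominant_iter_neq0 f r i : dominant f -> tnth (endo_iter f r) i != 0.
Proof.
move=> hf; apply/eqP => fi0; apply: (@dominant_iter_neqC f r i 0 hf).
by rewrite fi0 mpolyC0.
Qed.

Lemma endo_iter1 f : endo_iter f 1 = f.
Proof.
by apply: eq_from_tnth => i; rewrite endo_iter_comp comp_mpoly_id.
Qed.

Lemma dominant_neq0 f i : dominant f -> tnth f i != 0.
Proof. by move=> /dominant_iter_neq0 => /(_ 1 i); rewrite endo_iter1. Qed.

End Composition.

(** * Weights of monomials under products, substitution and iteration *)

Section WeightedSupport.
Variables (R : realType) (k : fieldType) (n : nat).
Implicit Types (mu : 'rV[R]_n) (f g : endo k n) (p q : {mpoly k[n]}).
Implicit Types (S T U : set R) (m : multinom n).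

Lemma mnm_weightD mu m m' :
  mnm_weight mu (mnm_add m m') = mnm_weight mu m + mnm_weight mu m'.
Proof.
rewrite /mnm_weight -big_split; apply: eq_bigr => i _.
by rewrite mnmDE natrD mulrDl.
Qed.

(** A set S of weights covers the conditions [<= d], [< d] and [= d] at once. The zero polynomial
    satisfies all of them, so degree -oo needs no separate treatment. *)
Definition weights_in mu S p := forall m, m \in msupp p -> S (mnm_weight mu m).

Lemma weights_inW mu S T p : S `<=` T -> weights_in mu S p -> weights_in mu T p.
Proof. by move=> ST pS m /pS /ST. Qed.

Lemma weights_in0 mu S : weights_in mu S (0 : {mpoly k[n]}).
Proof. by move=> m; rewrite msupp0. Qed.

Lemma weights_inD mu S p q :
  weights_in mu S p -> weights_in mu S q -> weights_in mu S (p + q).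
Proof. by move=> pS qS m /msuppD_le; rewrite mem_cat => /orP[/pS|/qS]. Qed.

Lemma weights_inZ mu S c p : weights_in mu S p -> weights_in mu S (c *: p).
Proof. by move=> pS m /msuppZ_le /pS. Qed.

Lemma weights_in_sum mu S (r : seq (multinom n)) (F : multinom n -> {mpoly k[n]}) :
  (forall m, m \in r -> weights_in mu S (F m)) ->
  weights_in mu S (\sum_(m <- r) F m).
Proof.
move=> FS; rewrite big_seq; elim/big_rec : _ => [|m p /FS mS pS].
  exact: weights_in0.
exact: weights_inD.
Qed.

Lemma weights_inM mu S T U p q : (forall a b, S a -> T b -> U (a + b)) ->
  weights_in mu S p -> weights_in mu T q -> weights_in mu U (p * q).
Proof.
move=> STU pS qT m /msuppM_le /allpairsP[[a b]] /= [/pS aS /qT bT ->].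
by rewrite mnm_weightD; exact: STU.
Qed.

Lemma weights_in1 mu S : S 0 -> weights_in mu S (1 : {mpoly k[n]}).
Proof.
move=> S0 m; rewrite msupp1 inE => /eqP ->.
by rewrite /mnm_weight big1 // => i _; rewrite mnm0E mul0r.
Qed.

(** q is the homogeneous part of degree d of a polynomial p of degree at most d; q may be 0. As d is
    only a bound on the degree, the relation is stable under products and substitution. *)
Definition is_part mu (d : R) p q :=
  weights_in mu [set t | t = d] q /\ weights_in mu [set t | t < d] (p - q).

Lemma is_part_le mu d p q : is_part mu d p q -> weights_in mu [set t | t <= d] p.
Proof.
move=> [qd pqd]; rewrite -(subrK q p); apply: weights_inD.
  by apply: weights_inW _ pqd => t /ltW.
by apply: weights_inW _ qd => t /= ->.
Qed.

Lemma is_partM mu d d' p q p' q' :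
  is_part mu d p q -> is_part mu d' p' q' -> is_part mu (d + d') (p * p') (q * q').
Proof.
move=> pq pq'; have [q_d pq_d] := pq; have [q_d' pq_d'] := pq'.
split; first by apply: (weights_inM _ q_d q_d') => a b /= -> ->.
have -> : p * p' - q * q' = (p - q) * p' + q * (p' - q') by ring.
apply: weights_inD.
  apply: (weights_inM _ pq_d (is_part_le pq')) => a b /=; lra.
apply: (weights_inM _ q_d pq_d') => a b /= ->; lra.
Qed.

Lemma is_part_prod mu (d : R) (e : 'rV[R]_n) (p q : 'I_n -> {mpoly k[n]}) m :
  (forall i, is_part mu (d * e 0 i) (p i) (q i)) ->
  is_part mu (d * mnm_weight e m) (\prod_i p i ^+ m i) (\prod_i q i ^+ m i).
Proof.
move=> pq; rewrite /mnm_weight mulr_sumr.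
have part1 : is_part mu 0 1 1.
  by split; [exact: weights_in1|rewrite subrr; exact: weights_in0].
apply: (big_ind3 (is_part mu)) => [//||i _].
  by move=> *; exact: is_partM.
elim: (m i) => [|j IH]; first by rewrite !expr0 mul0r mulr0.
rewrite !exprS -addn1 natrD.
have -> : d * ((j%:R + 1) * e 0 i) = d * e 0 i + d * (j%:R * e 0 i) by ring.
exact: is_partM.
Qed.

Lemma weights_le_prod mu (d : R) (e : 'rV[R]_n) (p : 'I_n -> {mpoly k[n]}) m :
  (forall i, weights_in mu [set t | t <= d * e 0 i] (p i)) ->
  weights_in mu [set t | t <= d * mnm_weight e m] (\prod_i p i ^+ m i).
Proof.
move=> pd; rewrite /mnm_weight mulr_sumr.
apply: (big_ind2 (fun p t => weights_in mu [set u | u <= t] p)) => [||i _].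
- by apply: weights_in1; rewrite /= lexx.
- move=> q a q' b qa qb; apply: (weights_inM _ qa qb) => x y /=; lra.
elim: (m i) => [|j IH].
  by rewrite expr0 mul0r mulr0; apply: weights_in1; rewrite /= lexx.
rewrite !exprS -addn1 natrD.
apply: (weights_inM _ (pd i) IH) => x y /=; lra.
Qed.

Lemma weights_le_comp mu (d t : R) (e : 'rV[R]_n) f p : 0 <= d ->
  (forall i, weights_in mu [set u | u <= d * e 0 i] (tnth f i)) ->
  weights_in e [set u | u <= t] p ->
  weights_in mu [set u | u <= d * t] (comp_mpoly f p).
Proof.
move=> d0 fd pt; rewrite comp_mpolyE; apply: weights_in_sum => m mp.
apply: weights_inZ.
apply: weights_inW _ (weights_le_prod (m := m) fd) => u /= /le_trans; apply.
by rewrite ler_wpM2l// pt.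
Qed.

Lemma is_part_comp mu (d t : R) f g p q : 0 < d ->
  (forall i, is_part mu (d * mu 0 i) (tnth f i) (tnth g i)) ->
  is_part mu t p q ->
  is_part mu (d * t) (comp_mpoly f p) (comp_mpoly g q).
Proof.
move=> d0 fg [qt pqt]; split.
  rewrite comp_mpolyE; apply: weights_in_sum => m mq.
  apply: weights_inZ.
  by rewrite -(qt m mq); case: (is_part_prod m fg).
(* The first summand has lower weight because p - q has weights below t and d > 0; the second
   because f and g agree up to lower weights in each monomial of q. *)
have -> : comp_mpoly f p - comp_mpoly g q =
  comp_mpoly f (p - q) + (comp_mpoly f q - comp_mpoly g q).
  by rewrite comp_mpolyB addrA subrK.
apply: weights_inD.
  rewrite comp_mpolyE; apply: weights_in_sum => m mp.
  apply: weights_inZ.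
  apply: weights_inW _ (weights_le_prod (m := m) (fun i => is_part_le (fg i))).
  move=> u /= /le_lt_trans; apply.
  by rewrite ltr_pM2l// pqt.
rewrite !(comp_mpolyE q) -sumrB; apply: weights_in_sum => m mq.
rewrite -scalerBr; apply: weights_inZ.
by rewrite -(qt m mq); case: (is_part_prod m fg).
Qed.

Lemma weights_le_iter mu (t : R) f r i : 0 <= t ->
  (forall j, weights_in mu [set u | u <= t * mu 0 j] (tnth f j)) ->
  weights_in mu [set u | u <= t ^+ r * mu 0 i] (tnth (endo_iter f r) i).
Proof.
move=> t0 ft; elim: r i => [|r IH] i.
  rewrite tnth_mktuple => m; rewrite msuppX inE => /eqP -> /=.
  rewrite expr0 mul1r /mnm_weight (bigD1 i) //= mnm1E eqxx mul1r big1 ?addr0 // => j ji.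
  by rewrite mnm1E eq_sym (negbTE ji) mul0r.
rewrite endo_iter_comp exprSr -mulrA.
apply: (weights_le_comp _ IH (ft i)); exact: exprn_ge0.
Qed.

Lemma is_part_iter mu (t : R) f g r i : 0 < t ->
  (forall j, is_part mu (t * mu 0 j) (tnth f j) (tnth g j)) ->
  is_part mu (t ^+ r * mu 0 i) (tnth (endo_iter f r) i) (tnth (endo_iter g r) i).
Proof.
move=> t0 fg; elim: r i => [|r IH] i.
  rewrite !tnth_mktuple; split; last by rewrite subrr; exact: weights_in0.
  move=> m; rewrite msuppX inE => /eqP -> /=.
  rewrite expr0 mul1r /mnm_weight (bigD1 i) //= mnm1E eqxx mul1r big1 ?addr0 // => j ji.
  by rewrite mnm1E eq_sym (negbTE ji) mul0r.
rewrite !endo_iter_comp exprSr -mulrA.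
apply: (is_part_comp _ IH (fg i)); exact: exprn_gt0.
Qed.

Lemma homog_part_is_part mu (d : R) p :
  weights_in mu [set u | u <= d] p -> is_part mu d p (homog_part mu d p).
Proof.
move=> pd; have wX S (m : multinom n) : S (mnm_weight mu m) ->
    weights_in mu S (mcoeff m p *: mpolyX k m).
  by move=> Sm; apply: weights_inZ => m'; rewrite msuppX inE => /eqP ->.
rewrite /homog_part; split.
  rewrite -big_filter; apply: weights_in_sum => m.
  by rewrite mem_filter => /andP[/eqP md _]; exact: wX.
rewrite {1}(mpolyE p) (bigID (fun m => mnm_weight mu m == d)) /=.
rewrite addrAC subrr add0r -big_filter; apply: weights_in_sum => m.
by rewrite mem_filter => /andP[md /pd /= mled]; apply: wX; rewrite /= lt_neqAle md.
Qed.

Lemma is_part_neq0 mu (d : R) p q : is_part mu d p q ->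
  (q != 0 <-> ~ weights_in mu [set u | u < d] p).
Proof.
move=> [qd pqd]; split=> [q0 pd|npd]; last first.
  by apply/eqP => q0; apply: npd; rewrite q0 subr0 in pqd.
have : weights_in mu [set u | u < d] q.
  rewrite -(subKr p q); apply: weights_inD => //.
  by move=> m; rewrite (perm_mem (msuppN _)) => /pqd.
move: q0; rewrite -msupp_eq0; case E: (msupp q) => [|m s] // _ /(_ m).
rewrite E mem_head => /(_ isT) /=; rewrite qd ?ltxx // E; exact: mem_head.
Qed.

End WeightedSupport.

(** * Comparing a maximum over a sequence with a bound *)

Section BigmaxSeq.
Context {d : Order.disp_t} {T : orderType d} {I : eqType}.
Implicit Types (x y : T) (r : seq I) (F : I -> T).

Lemma bigmax_seq_leP x y r F :
  (\big[Order.max/x]_(i <- r) F i <= y)%O <->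
  (x <= y)%O /\ (forall i, i \in r -> (F i <= y)%O).
Proof.
split=> [le_y|[xy Fy]]; last by rewrite big_seq bigmax_le.
split=> [|i ir]; first by apply: le_trans le_y; exact: bigmax_ge_id.
by apply: le_trans le_y; exact: le_bigmax_seq.
Qed.

Lemma bigmax_seq_ltP x y r F :
  (\big[Order.max/x]_(i <- r) F i < y)%O <->
  (x < y)%O /\ (forall i, i \in r -> (F i < y)%O).
Proof.
split=> [lt_y|[xy Fy]]; last by rewrite big_seq bigmax_lt.
split=> [|i ir]; first by apply: le_lt_trans lt_y; exact: bigmax_ge_id.
by apply: le_lt_trans lt_y; exact: le_bigmax_seq.
Qed.

End BigmaxSeq.

(** * Weighted degree, total degree, and their comparison *)

Section Degrees.
Variables (R : realType) (k : fieldType) (n : nat).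
Implicit Types (mu : 'rV[R]_n) (f g : endo k n) (p q : {mpoly k[n]}) (m : multinom n).

Lemma deg_mu_leP mu p (d : R) :
  (deg_mu mu p <= d%:E)%E <-> weights_in mu [set t | t <= d] p.
Proof.
rewrite /deg_mu; split=> [/bigmax_seq_leP[_ pd] m mp|pd].
  by have := pd m mp; rewrite lee_fin.
by apply/bigmax_seq_leP; split=> [|m mp]; rewrite ?leNye// lee_fin; exact: pd.
Qed.

Lemma deg_mu_eqP mu p (d : R) : deg_mu mu p = d%:E <->
  weights_in mu [set t | t <= d] p /\ ~ weights_in mu [set t | t < d] p.
Proof.
have deg_lt : (deg_mu mu p < d%:E)%E <-> weights_in mu [set t | t < d] p.
  rewrite /deg_mu; split=> [/bigmax_seq_ltP[_ pd] m mp|pd].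
    by have := pd m mp; rewrite lte_fin.
  by apply/bigmax_seq_ltP; split=> [|m mp]; rewrite ?ltNyr// lte_fin; exact: pd.
rewrite -deg_mu_leP -deg_lt; split=> [->|[le_d /negP]].
  by rewrite ltxx lexx.
by rewrite -leNgt => ge_d; apply/eqP; rewrite eq_le le_d ge_d.
Qed.

Lemma not_weights_lt mu p (d : R) : ~ weights_in mu [set t | t < d] p ->
  exists2 m, m \in msupp p & d <= mnm_weight mu m.
Proof.
move=> npd; apply: contrapT => nex; apply: npd => m mp /=.
by rewrite ltNge; apply/negP => dm; apply: nex; exists m.
Qed.

Lemma endo_deg_mu_le mu f (t : R) : 0 <= t ->
  (forall i, weights_in mu [set u | u <= t * mu 0 i] (tnth f i)) ->
  (endo_deg_mu mu f <= t%:E)%E.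
Proof.
move=> t0 ft; apply: ereal_inf_lbound; exists t => //; split=> // i.
exact/deg_mu_leP.
Qed.

Lemma endo_deg_mu_lt mu f (t : R) : (endo_deg_mu mu f < t%:E)%E ->
  exists2 u, 0 <= u < t &
    forall i, weights_in mu [set w | w <= u * mu 0 i] (tnth f i).
Proof.
move=> /ereal_inf_lt[_ [u [u0 fu] <-]]; rewrite lte_fin => ut.
by exists u; [rewrite u0|move=> i; apply/deg_mu_leP].
Qed.

(** Only finitely many monomials occur, so strict inequality in every component of positive weight
    leaves room for a bound smaller than t. *)
Lemma endo_deg_mu_eqP mu f (t : R) : 0 < t -> (forall i, 0 <= mu 0 i) ->
  (forall i, weights_in mu [set u | u <= t * mu 0 i] (tnth f i)) ->
  endo_deg_mu mu f = t%:E <->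
  exists i, 0 < mu 0 i /\ ~ weights_in mu [set u | u < t * mu 0 i] (tnth f i).
Proof.
move=> t0 mu0 ft; have le_t := endo_deg_mu_le (ltW t0) ft.
split=> [deg_eq|[i [mui nlt]]]; last first.
  apply/eqP; rewrite eq_le le_t leNgt; apply/negP => /endo_deg_mu_lt[u /andP[_ ut] fu].
  apply: nlt; apply: weights_inW _ (fu i) => w /= /le_lt_trans; apply.
  by rewrite ltr_pM2r.
apply: contrapT => nex.
have f_lt i : 0 < mu 0 i -> weights_in mu [set u | u < t * mu 0 i] (tnth f i).
  by move=> mui; apply: contrapT => nlt; apply: nex; exists i.
(* The least factor that works for all the components of positive weight. *)
pose u := \big[Num.max/0]_(i | 0 < mu 0 i)
  \big[Num.max/0]_(m <- msupp (tnth f i)) (mnm_weight mu m / mu 0 i).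
have u0 : 0 <= u by apply: bigmax_ge_id.
have ut : u < t.
  apply: bigmax_lt => // i mui; apply/bigmax_seq_ltP; split=> // m mf.
  by rewrite ltr_pdivrMr//; exact: f_lt.
suff : (endo_deg_mu mu f <= u%:E)%E by rewrite deg_eq lee_fin leNgt ut.
apply: endo_deg_mu_le => // i m mf /=.
(* If [mu 0 i = 0], the bound is 0 whatever the factor, and [ft] already gives it. *)
move: (mu0 i); rewrite le_eqVlt => /orP[/eqP mui|mui].
  by have := ft i m mf; rewrite /= -mui !mulr0.
rewrite -ler_pdivrMr//; apply: le_trans (le_bigmax_cond _ _ mui).
by have /bigmax_seq_leP[_ ->] := lexx (\big[Num.max/0]_(m <- msupp (tnth f i))
  (mnm_weight mu m / mu 0 i)).
Qed.

Lemma mnm_weight1 m : mnm_weight (const_mx 1) m = (mdeg m)%:R :> R.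
Proof.
by rewrite mdegE natr_sum; apply: eq_bigr => i _; rewrite mxE mulr1.
Qed.

Lemma mdeg_le_endo_deg f i m : m \in msupp (tnth f i) -> (mdeg m <= endo_deg f)%N.
Proof.
move=> mf; apply: leq_trans (leq_bigmax i).
by rewrite -ltnS (leq_trans (mmeasure_mnm_lt _ mf))// leqSpred.
Qed.

Lemma endo_deg_le f (d : R) : 0 <= d ->
  (forall i m, m \in msupp (tnth f i) -> (mdeg m)%:R <= d) ->
  (endo_deg f)%:R <= d.
Proof.
move=> d0 fd; rewrite /endo_deg.
have max_le (a b : nat) : a%:R <= d -> b%:R <= d -> (maxn a b)%:R <= d.
  by rewrite /maxn; case: ifP.
apply: (big_ind (fun x : nat => x%:R <= d)) => // i _.
have [->|fi0] := eqVneq (tnth f i) 0; first by rewrite mmeasure0.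
rewrite /mmeasure big_seq.
(* [mmeasure mdeg] is a maximum of successors of degrees, hence the predecessor; the initial value 0
   is its own predecessor. *)
apply: (big_ind (fun x : nat => x.-1%:R <= d)) => //; last by move=> m /fd.
by move=> [|a] [|b] //=; rewrite maxnSS; exact: max_le.
Qed.

(** Total degree is the weight for the all-ones vector, so this is a case of [weights_le_comp]. *)
Lemma endo_deg_comp f g :
  (endo_deg (endo_comp f g) <= endo_deg f * endo_deg g)%N.
Proof.
rewrite -(ler_nat R); apply: endo_deg_le => // i m.
rewrite tnth_mktuple mulnC natrM -mnm_weight1.
move: m; apply: (@weights_le_comp _ _ _ _ _ _ (const_mx 1)) => //
  [j|] m /mdeg_le_endo_deg /=.
  by rewrite mnm_weight1 mxE mulr1 ler_nat.
by rewrite mnm_weight1 ler_nat.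
Qed.

Lemma endo_deg_iterD f r s :
  (endo_deg (endo_iter f (r + s)) <=
    endo_deg (endo_iter f r) * endo_deg (endo_iter f s))%N.
Proof.
have -> : endo_iter f (r + s) = endo_comp (endo_iter f r) (endo_iter f s).
  by apply: eq_from_tnth => i; rewrite endo_iterD tnth_mktuple.
exact: endo_deg_comp.
Qed.

(** Degree 0 would make a component of the iterate constant. Fekete's lemma is applied to this
    positive sequence. *)
Lemma endo_deg_iter_gt0 f r : (0 < n)%N -> dominant f ->
  (0 < endo_deg (endo_iter f r))%N.
Proof.
move=> n0 hf; rewrite lt0n; apply/eqP => deg0.
pose i := Ordinal n0.
apply: (@dominant_iter_neqC _ _ f r i (mcoeff mnm0 (tnth (endo_iter f r) i)) hf).
apply/mpolyP => m; rewrite mcoeffC eq_sym.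
have [->|m0] := eqVneq; first by rewrite mulr1.
rewrite mulr0; apply: memN_msupp_eq0; apply/negP => /mdeg_le_endo_deg.
by rewrite deg0 leqn0 mdeg_eq0 eq_sym (negbTE m0).
Qed.

(** The constant lost in passing between weighted and total degree, in either direction. As
    [0^-1 = 0], zero weights add nothing to the second sum. *)
Definition distortion mu := (\sum_i mu 0 i) * \sum_i (mu 0 i)^-1.

Lemma mnm_weight_le mu m : (forall i, 0 <= mu 0 i) ->
  mnm_weight mu m <= (mdeg m)%:R * \sum_i mu 0 i.
Proof.
move=> mu0; rewrite mdegE natr_sum mulr_suml; apply: ler_sum => i _.
by rewrite ler_wpM2l// (bigD1 i)//= lerDl sumr_ge0.
Qed.

Lemma mdeg_le_weight mu m : (forall i, 0 < mu 0 i) ->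
  (mdeg m)%:R <= mnm_weight mu m * \sum_i (mu 0 i)^-1.
Proof.
move=> mu0; rewrite mdegE natr_sum mulr_suml; apply: ler_sum => i _.
rewrite -mulrA ler_peMr// (bigD1 i)//= mulrDr mulfV ?gt_eqF// lerDl.
by rewrite mulr_ge0 ?(ltW (mu0 i))// sumr_ge0// => j _; rewrite invr_ge0 ltW.
Qed.

Lemma endo_deg_le_distortion mu f (t : R) : (forall i, 0 < mu 0 i) -> 0 <= t ->
  (forall i, weights_in mu [set u | u <= t * mu 0 i] (tnth f i)) ->
  (endo_deg f)%:R <= distortion mu * t.
Proof.
move=> mu0 t0 ft; have mu0' i : 0 <= mu 0 i := ltW (mu0 i).
have inv0 : 0 <= \sum_i (mu 0 i)^-1 by apply: sumr_ge0 => i _; rewrite invr_ge0.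
apply: endo_deg_le => [|i m mf].
  by rewrite !mulr_ge0// sumr_ge0.
apply: le_trans (mdeg_le_weight _ mu0) _.
rewrite mulrAC ler_wpM2r//; apply: le_trans (ft i m mf) _.
by rewrite mulrC ler_wpM2r// (bigD1 i)//= lerDl sumr_ge0.
Qed.

Lemma le_distortion_endo_deg mu f (t : R) i : (forall i, 0 <= mu 0 i) -> 0 < mu 0 i ->
  ~ weights_in mu [set u | u < t * mu 0 i] (tnth f i) ->
  t <= distortion mu * (endo_deg f)%:R.
Proof.
move=> mu0 mui /not_weights_lt[m mf tm].
have := le_trans tm (mnm_weight_le m mu0).
rewrite -ler_pdivlMr// => /le_trans; apply.
rewrite [leRHS]mulrAC [_ * (endo_deg f)%:R]mulrC; apply: ler_pM.
- by rewrite mulr_ge0// sumr_ge0.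
- by rewrite invr_ge0.
- by rewrite ler_wpM2r ?sumr_ge0// ler_nat (mdeg_le_endo_deg mf).
by rewrite (bigD1 i)//= lerDl sumr_ge0// => j _; rewrite invr_ge0.
Qed.

Lemma distortion_ge0 mu : (forall i, 0 <= mu 0 i) -> 0 <= distortion mu.
Proof.
by move=> mu0; rewrite mulr_ge0// sumr_ge0// => i _; rewrite invr_ge0.
Qed.

End Degrees.

(** * Comparing exponential growth rates *)

Section ExponentialGrowth.
Context {R : realType}.
Implicit Types (a b c : R).

Lemma expr_eventually_gt a c : 1 < a -> exists N, forall r, (N <= r)%N -> c < a ^+ r.
Proof.
move=> a1.
(* Bernoulli's inequality. *)
have bern r : 1 + r%:R * (a - 1) <= a ^+ r.
  elim: r => [|r IH]; first by rewrite mul0r addr0 expr0.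
  have a0 : 0 <= a by lra.
  rewrite exprS; apply: le_trans (ler_wpM2l a0 IH).
  have : 0 <= r%:R * (a - 1) ^+ 2 by rewrite mulr_ge0 ?sqr_ge0.
  rewrite -natr1; lra.
exists (Num.bound `|c / (a - 1)|) => r Nr; apply: lt_le_trans (bern r).
have a10 : 0 < a - 1 by lra.
suff : c < r%:R * (a - 1) by lra.
rewrite -ltr_pdivrMr//; apply: le_lt_trans (ler_norm _) _.
by apply: lt_le_trans (archi_boundP _) _; rewrite ?ler_nat.
Qed.

(** If b < a, the powers of a / b eventually exceed c; the case b = 0 is settled by r = 1. *)
Lemma le_of_expr_bound a b c : 0 <= a -> 0 <= b ->
  (forall r, a ^+ r <= c * b ^+ r) -> a <= b.
Proof.
move=> a0 b0 ab; rewrite leNgt; apply/negP => ba.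
have [b_eq0|b_neq0] := eqVneq b 0.
  by have := ab 1; rewrite !expr1 b_eq0 mulr0 leNgt -{1}b_eq0 ba.
have bgt0 : 0 < b by rewrite lt_def b_neq0.
have [|N /(_ N (leqnn N))] := @expr_eventually_gt (a / b) c.
  by rewrite ltr_pdivlMr// mul1r.
by rewrite expr_div_n ltr_pdivlMr ?exprn_gt0// ltNge ab.
Qed.

End ExponentialGrowth.

(** * Fekete's lemma for submultiplicative sequences of positive integers *)

Section Fekete.
Variables (R : realType) (D : nat -> nat).
Hypotheses (D_gt0 : forall r, (0 < D r)%N)
  (D_submul : forall r s, (D (r + s) <= D r * D s)%N).

Let u r : R := (D r)%:R `^ (r%:R^-1).
Let roots := [set u r.+1 | r in [set: nat]].
Let L := inf roots.

Let uX r : u r.+1 ^+ r.+1 = (D r.+1)%:R.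
Proof. by rewrite -powR_mulrn ?powR_ge0// -powRrM mulVf// powRr1. Qed.

Let u_ge1 r : 1 <= u r.+1.
Proof.
rewrite -(ler_pXn2r (ltn0Sn r)) ?nnegrE ?powR_ge0//.
by rewrite expr1n uX ler1n.
Qed.

Let roots_inf : has_inf roots.
Proof. by split; [exists (u 1); exists 0%N|exists 1 => _ [r _ <-]; exact: u_ge1]. Qed.

Let L_ge1 : 1 <= L.
Proof. by apply: lb_le_inf; [exact: roots_inf.1|move=> _ [r _ <-]; exact: u_ge1]. Qed.

Let L_le r : L <= u r.+1.
Proof. by apply: ge_inf; [exact: roots_inf.2|exists r]. Qed.

Let D_blocks m q t : (D (q * m + t) <= D m ^ q * D t)%N.
Proof.
elim: q => [|q IH]; first by rewrite mul1n.
by rewrite mulSn -addnA expnS -mulnA (leq_trans (D_submul _ _))// leq_mul2l IH orbT.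
Qed.

(** Cut r into blocks of a length m + 1 whose root [u m.+1] is below a. The remainder takes finitely
    many values, so the sum of the corresponding [D t] serves as c. *)
Let D_le a : L < a -> exists c : R, forall r, (D r)%:R <= c * a ^+ r.
Proof.
move=> /(inf_lt roots_inf.1)[_ [m _ <-] ua].
have a1 : 1 <= a := le_trans (u_ge1 m) (ltW ua).
have a0 : 0 <= a by lra.
exists (\sum_(t < m.+1) (D t)%:R) => r.
rewrite {1}(divn_eq r m.+1).
have le_a : (D m.+1)%:R <= a ^+ m.+1.
  by rewrite -uX lerXn2r ?nnegrE ?powR_ge0// ltW.
apply: le_trans (_ : (D m.+1 ^ (r %/ m.+1) * D (r %% m.+1))%:R <= _).
  by rewrite ler_nat.
rewrite natrM natrX mulrC; apply: ler_pM; rewrite ?exprn_ge0//.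
  have rm : (r %% m.+1 < m.+1)%N by rewrite ltn_mod.
  by rewrite (bigD1 (Ordinal rm))//= lerDl sumr_ge0.
apply: le_trans (_ : (a ^+ m.+1) ^+ (r %/ m.+1) <= _).
  by apply: lerXn2r => //; rewrite nnegrE ?exprn_ge0.
by rewrite -exprM ler_weXn2l// mulnC leq_trunc_div.
Qed.

Let cvg_u : u @ \oo --> L.
Proof.
apply/cvgrPdist_le => e e0.
have [|c Dc] := D_le (_ : L < L + e / 2); first lra.
(* [D r] is at most c (L + e/2)^r, and the powers of this ratio, which exceeds 1, absorb c for large
   r. *)
have [|N HN] := @expr_eventually_gt R ((L + e) / (L + e / 2)) c.
  by have L1 := L_ge1; rewrite ltr_pdivlMr ?mul1r; lra.
(* The successor excludes r = 0, where [u] is not a genuine root. *)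
exists N.+1 => // -[//|r] /= Nr.
rewrite distrC ger0_norm ?subr_ge0// lerBlDl.
have := HN r.+1 (ltnW Nr).
have Le0 : 0 < L + e / 2 by have L1 := L_ge1; lra.
rewrite expr_div_n ltr_pdivlMr ?exprn_gt0// => /(le_lt_trans (Dc _)).
rewrite -uX ltr_pXn2r ?nnegrE ?powR_ge0//; first exact: ltW.
by have L1 := L_ge1; lra.
Qed.

(** The limit is the infimum [L] of the roots, for which the three claims are already available. *)
Lemma fekete (l := limn u) :
  [/\ 1 <= l, forall r, l ^+ r <= (D r)%:R &
      forall a, l < a -> exists c : R, forall r, (D r)%:R <= c * a ^+ r].
Proof.
have -> : l = L by apply/cvg_lim.
split=> // -[|r]; first by rewrite expr0 ler1n.
rewrite -uX lerXn2r ?nnegrE ?powR_ge0//.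
by have L1 := L_ge1; lra.
Qed.

End Fekete.

(** * Continuity of finite sums and maxima *)

Section ContinuousBig.
Context {R : realType} {X : topologicalType} {I : Type}.
Variables (r : seq I) (F : I -> X -> R).
Hypothesis F_cont : forall i, continuous (F i).

Lemma continuous_sumr : continuous (fun x => \sum_(i <- r) F i x).
Proof.
by move=> x; apply: cvg_big => [|i _]; [exact: add_continuous|exact: F_cont].
Qed.

Lemma continuous_bigmaxr (c : R) :
  continuous (fun x => \big[Num.max/c]_(i <- r) F i x).
Proof.
by move=> x; apply: cvg_big => [|i _]; [exact: max_continuous|exact: F_cont].
Qed.

End ContinuousBig.

(** * Nonlinear Perron-Frobenius theorem for monotone homogeneous continuous maps *)

Section NonlinearPerronFrobenius.
Variables (R : realType) (n : nat) (T : 'rV[R]_n -> 'rV[R]_n).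
Implicit Types (u v w : 'rV[R]_n) (s t : R).
Hypotheses (n_gt0 : (0 < n)%N)
  (T_mono : forall u v, (forall i, u 0 i <= v 0 i) -> forall i, T u 0 i <= T v 0 i)
  (T_homo : forall (c : R) u, 0 <= c -> T (c *: u) = c *: T u)
  (T_cont : forall i, continuous (fun u => T u 0 i)).

(** The infimum [s0] of this set is the Collatz-Wielandt number of T, the future eigenvalue. *)
Let supersolution := [set s | exists v, (forall i, 0 < v 0 i) /\
  forall i, T v 0 i <= s * v 0 i].
Let s0 := inf supersolution.
Let i0 := Ordinal n_gt0.

Let T_ge0 u i : (forall i, 0 <= u 0 i) -> 0 <= T u 0 i.
Proof.
move=> u0; have <- : T 0 0 i = 0 by rewrite -(scale0r u) T_homo// scale0r mxE.
by apply: T_mono => j; rewrite mxE.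
Qed.

Let supersolution_ge0 s : supersolution s -> 0 <= s.
Proof.
move=> [v [v0 Tv]]; rewrite -(pmulr_lge0 _ (v0 i0)).
by apply: le_trans (Tv i0); apply: T_ge0 => i; exact: ltW.
Qed.

Let supersolution_inf : has_inf supersolution.
Proof.
split; last by exists 0 => s /supersolution_ge0.
exists (\sum_i T (const_mx 1) 0 i), (const_mx 1); split=> i; rewrite !mxE// mulr1.
by rewrite (bigD1 i)//= lerDl sumr_ge0// => j _; apply: T_ge0 => l; rewrite mxE.
Qed.

Let s0_ge0 : 0 <= s0.
Proof. by apply: lb_le_inf; [exact: supersolution_inf.1|exact: supersolution_ge0]. Qed.

(* The coordinatewise infimum of the set of v >= 0 with T v + 1 <= t v belongs
   to this set; since T is monotone, so does (T v + 1) / t, hence equality. *)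
Let resolvent t : s0 < t ->
  exists v, (forall i, 0 < v 0 i) /\ (forall i, T v 0 i + 1 = t * v 0 i).
Proof.
move=> s0t; have t0 : 0 < t := le_lt_trans s0_ge0 s0t.
have [s [w [w0 Tw]] st] := inf_lt supersolution_inf.1 s0t.
pose S := [set v : 'rV[R]_n | (forall i, 0 <= v 0 i) /\
  forall i, T v 0 i + 1 <= t * v 0 i].
have S0 : S !=set0.
  (* Large enough that c (t - s) w_i >= 1 for all i, so the gap between s and t pays for the added
     1. *)
  pose c := \sum_i ((t - s) * w 0 i)^-1.
  have ts0 i : 0 < (t - s) * w 0 i by rewrite mulr_gt0// subr_gt0.
  have c0 : 0 <= c by apply: sumr_ge0 => i _; rewrite invr_ge0 ltW.
  exists (c *: w); split=> i; first by rewrite mxE mulr_ge0// ltW.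
  rewrite T_homo// !mxE.
  have : 1 <= c * ((t - s) * w 0 i).
    rewrite -ler_pdivrMr// mul1r /c (bigD1 i)//= lerDl.
    by apply: sumr_ge0 => j _; rewrite invr_ge0 ltW.
  have := ler_wpM2l c0 (Tw i); nra.
pose Si i := (fun v : 'rV[R]_n => v 0 i) @` S.
have Si_inf i : has_inf (Si i).
  split; first by have [v Sv] := S0; exists (v 0 i), v.
  by exists 0 => _ [v [v0 _] <-].
pose v : 'rV[R]_n := \row_i inf (Si i).
have v_le u i : S u -> v 0 i <= u 0 i.
  by move=> Su; rewrite mxE; apply: ge_inf; [exact: (Si_inf i).2|exists u].
have v_ge0 i : 0 <= v 0 i.
  by rewrite mxE; apply: lb_le_inf; [exact: (Si_inf i).1|move=> _ [u [u0 _] <-]].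
have Tv i : T v 0 i + 1 <= t * v 0 i.
  rewrite mulrC -ler_pdivrMr// mxE; apply: lb_le_inf; first exact: (Si_inf i).1.
  move=> _ [u Su <-]; rewrite ler_pdivrMr// mulrC; apply: le_trans (Su.2 i).
  by rewrite lerD2r; apply: T_mono => j; exact: v_le.
have Tv_ge0 i : 0 <= T v 0 i by exact: T_ge0.
exists v; split=> i.
  by rewrite -(pmulr_rgt0 _ t0); apply: lt_le_trans (Tv i); rewrite ltr_wpDl.
apply/eqP; rewrite eq_le Tv mulrC -ler_pdivlMr//.
pose w' : 'rV[R]_n := \row_i ((T v 0 i + 1) / t).
have -> : (T v 0 i + 1) / t = w' 0 i by rewrite mxE.
apply: v_le; split=> j; rewrite mxE; first by rewrite divr_ge0 ?addr_ge0// ltW.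
rewrite mulrC divfK ?gt_eqF// lerD2r; apply: T_mono => l.
by rewrite mxE ler_pdivrMr// mulrC.
Qed.

Let defect u : R := \sum_i `|T u 0 i - s0 * u 0 i|.

Let simplex :=
  [set u : 'rV[R]_n | (forall i, `[0, 1]%classic (u 0 i)) /\ \sum_i u 0 i = 1].

(** The resolvent vector v for a parameter just above [s0] satisfies the eigenvector equation up to
    a constant 1. Its total mass c is large, so after normalisation this error becomes the small
    number 1 / c. *)
Let small_defect (e : R) : 0 < e -> exists2 u, simplex u & defect u <= e.
Proof.
move=> e0; pose d := e / (2 * n%:R).
have d0 : 0 < d by rewrite divr_gt0// mulr_gt0// ltr0n.
have [|v [v0 Tv]] := @resolvent (s0 + d / 2); first lra.
have v0' i : 0 <= v 0 i := ltW (v0 i).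
pose c := \sum_i v 0 i.
have v_le i : v 0 i <= c by rewrite /c (bigD1 i)//= lerDl sumr_ge0.
have c0 : 0 < c := lt_le_trans (v0 i0) (v_le i0).
have cd : c^-1 < d.
  rewrite ltNge; apply/negP => dc.
  (* If c were at most 1 / d, then d v_i <= 1 for all i, and v would be a supersolution for s0 - d /
     2, below the infimum. *)
  suff : s0 <= s0 - d / 2 by lra.
  apply: ge_inf; first exact: supersolution_inf.2.
  exists v; split=> // i; have := Tv i.
  have : d * v 0 i <= 1.
    apply: le_trans (ler_pM (ltW d0) (v0' i) dc (v_le i)) _.
    by rewrite mulVf// gt_eqF.
  lra.
exists (c^-1 *: v).
  split=> [i|]; last first.
    under eq_bigr do rewrite mxE.
    by rewrite -mulr_sumr mulVf// gt_eqF.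
  rewrite /= in_itv/= mxE mulr_ge0 ?invr_ge0 ?(ltW c0)//=.
  by rewrite mulrC ler_pdivrMr// mul1r.
rewrite /defect T_homo ?invr_ge0 ?(ltW c0)//.
apply: le_trans (_ : \sum_(i < n) e / n%:R <= _); last first.
  by rewrite sumr_const card_ord -[_ *+ n]mulr_natr divfK// pnatr_eq0 -lt0n.
apply: ler_sum => i _; rewrite !mxE.
have -> : c^-1 * T v 0 i - s0 * (c^-1 * v 0 i) = d / 2 * (c^-1 * v 0 i) - c^-1.
  have -> : T v 0 i = (s0 + d / 2) * v 0 i - 1 by rewrite -Tv addrK.
  ring.
have cv1 : c^-1 * v 0 i <= 1 by rewrite mulrC ler_pdivrMr// mul1r.
have cv0 : 0 <= c^-1 * v 0 i by rewrite mulr_ge0// invr_ge0 ltW.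
have -> : e / n%:R = 2 * d.
  by rewrite /d; field; rewrite pnatr_eq0 -lt0n.
have cV0 : 0 < c^-1 by rewrite invr_gt0.
rewrite ler_norml; apply/andP; split; nra.
Qed.

Let simplex_compact : compact simplex.
Proof.
have -> : simplex = [set u : 'rV[R]_n | forall i, `[0, 1]%classic (u 0 i)] `&`
    (fun u : 'rV[R]_n => \sum_i u 0 i) @^-1` [set x | x = 1] by apply/seteqP; split.
apply: compact_closedI; first exact: (rV_compact (fun=> @segment_compact R 0 1)).
apply: preimage_closed; last exact: closed_eq.
by move=> u _; apply: continuous_sumr => i; exact: coord_continuous.
Qed.

(** [defect] attains its minimum on the compact simplex, and [small_defect] forces this minimum to
    be 0. The last clause comes from [s0] being an infimum. *)
Lemma perron_frobenius : exists s u,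
  [/\ 0 <= s, forall i, 0 <= u 0 i, u != 0, forall i, T u 0 i = s * u 0 i &
      forall t, s < t -> exists v, (forall i, 0 < v 0 i) /\
        forall i, T v 0 i <= t * v 0 i].
Proof.
have simplex0 : simplex !=set0.
  by have [u su _] := small_defect ltr01; exists u.
have cont_defect : {within simplex, continuous defect}.
  apply: continuous_subspaceT; apply: continuous_sumr => i u.
  apply: (@continuous_comp _ _ _ (fun u => T u 0 i - s0 * u 0 i) Num.norm).
    apply: continuousB; first exact: T_cont.
    apply: continuousM; [exact: cst_continuous|exact: coord_continuous].
  exact: norm_continuous.
have [u] := EVT_min_rV simplex0 simplex_compact cont_defect.
rewrite inE => -[u01 sum_u] u_min.
have defect0 : defect u = 0.
  apply/eqP; rewrite eq_le sumr_ge0// andbT; apply/ler_addgt0Pr => e e0.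
  rewrite add0r; have [v sv] := small_defect e0; apply: le_trans.
  by apply: u_min; rewrite inE.
exists s0, u; split => //.
- by move=> i; have := u01 i; rewrite /= in_itv/= => /andP[].
- apply/eqP => u0; move: sum_u; rewrite u0 big1 => [/eqP|i _]; last by rewrite mxE.
  by rewrite eq_sym oner_eq0.
- move=> i; apply/eqP; rewrite -subr_eq0 -normr_eq0.
  move/eqP: defect0; rewrite psumr_eq0// => /allP/(_ i); apply.
  by rewrite mem_index_enum.
move=> t /(inf_lt supersolution_inf.1)[s [v [v0 Tv]] st].
exists v; split=> // i; apply: le_trans (Tv i) _.
by rewrite ler_wpM2r// ltW.
Qed.

End NonlinearPerronFrobenius.

(** * The maximal eigenvalue as the Perron root of the degree map *)

Section MaximalEigenvalue.
Variables (R : realType) (k : fieldType) (n : nat) (f : endo k n).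
Hypotheses (n_gt0 : (0 < n)%N) (f_neq0 : forall i, tnth f i != 0).
Implicit Types (mu nu : 'rV[R]_n) (M : 'M[nat]_n) (m : multinom n) (t : R).

(* The maximum of M *m mu over the matrices M contained in f. *)
Definition deg_map mu : 'rV[R]_n :=
  \row_i \big[Num.max/0]_(m <- msupp (tnth f i)) mnm_weight mu m.

Lemma mnm_weight_ge0 mu m : (forall i, 0 <= mu 0 i) -> 0 <= mnm_weight mu m.
Proof. by move=> mu0; apply: sumr_ge0 => i _; rewrite mulr_ge0. Qed.

Lemma mnm_weightZ c mu m : mnm_weight (c *: mu) m = c * mnm_weight mu m.
Proof.
rewrite /mnm_weight mulr_sumr; apply: eq_bigr => i _.
by rewrite mxE mulrCA.
Qed.

Lemma weights_le_deg_map mu i t : 0 <= t ->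
  weights_in mu [set u | u <= t] (tnth f i) <-> deg_map mu 0 i <= t.
Proof.
move=> t0; rewrite mxE; split=> [ft|/bigmax_seq_leP[_ ft] //].
by apply/bigmax_seq_leP.
Qed.

Lemma deg_map_ge0 mu i : 0 <= deg_map mu 0 i.
Proof. by rewrite mxE; apply: bigmax_ge_id. Qed.

Lemma deg_map_mono mu nu : (forall i, mu 0 i <= nu 0 i) ->
  forall i, deg_map mu 0 i <= deg_map nu 0 i.
Proof.
move=> munu i; apply/weights_le_deg_map; first exact: deg_map_ge0.
have := (weights_le_deg_map nu i (deg_map_ge0 nu i)).2 (lexx _).
move=> h m /h /=; apply: le_trans; apply: ler_sum => j _.
by rewrite ler_wpM2l.
Qed.

Lemma deg_mapZ (c : R) mu : 0 <= c -> deg_map (c *: mu) = c *: deg_map mu.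
Proof.
move=> c0; apply/rowP => i; rewrite !mxE.
rewrite (big_morph ( *%R c) (id1 := 0) (op1 := Num.max)).
- by apply: eq_bigr => m _; rewrite mnm_weightZ.
- by move=> x y; rewrite maxr_pMr.
- by rewrite mulr0.
Qed.

Lemma deg_map_continuous i : continuous (fun mu => deg_map mu 0 i).
Proof.
under eq_fun do rewrite mxE.
apply: continuous_bigmaxr => m; apply: continuous_sumr => j mu.
apply: (@continuousM R _ (fun=> (m j)%:R) (fun nu : 'rV[R]_n => nu 0 j)).
  exact: cst_continuous.
exact: coord_continuous.
Qed.

Lemma deg_mu_deg_map mu i : (forall j, 0 <= mu 0 j) ->
  deg_mu mu (tnth f i) = (deg_map mu 0 i)%:E.
Proof.
move=> mu0; apply/deg_mu_eqP; split.
  by apply/weights_le_deg_map; rewrite ?deg_map_ge0.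
(* If the maximum is 0 it may come from the default value alone, so a monomial of the nonzero
   component is used, whose weight is nonnegative. *)
move=> f_lt; have := deg_map_ge0 mu i; rewrite le_eqVlt => /orP[/eqP d0|d0].
  have := f_neq0 i; rewrite -msupp_eq0; case E : (msupp (tnth f i)) => [|m s] // _.
  have /f_lt /= : m \in msupp (tnth f i) by rewrite E mem_head.
  by rewrite -d0 ltNge mnm_weight_ge0.
suff : deg_map mu 0 i < deg_map mu 0 i by rewrite ltxx.
by rewrite {1}mxE; apply/bigmax_seq_ltP.
Qed.

Lemma eigen_moduli_of_eigenvector mu t : 0 <= t -> mu != 0 ->
  (forall i, deg_mu mu (tnth f i) = (t * mu 0 i)%:E) -> eigen_moduli f t.
Proof.
move=> t0 mu_neq0 mu_eigen.
have /choice[m m_prop] i :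
    exists m, m \in msupp (tnth f i) /\ mnm_weight mu m = t * mu 0 i.
  have [le_t /not_weights_lt[m mf lem]] := (deg_mu_eqP _ _ _).1 (mu_eigen i).
  by exists m; split=> //; apply/eqP; rewrite eq_le lem le_t.
(* The rows are monomials attaining the weighted degrees, so mu is a column eigenvector of M for
   t. *)
pose M : 'M[nat]_n := \matrix_(i, j) m i j.
exists M, (t%:C)%C; split.
- move=> i; rewrite -mcoeff_msupp (_ : Multinom _ = m i); first exact: (m_prop i).1.
  by apply/mnmP => j; rewrite multinomE tnth_mktuple mxE.
(* [eigenvalue] refers to row vectors while mu is a column eigenvector; singularity of M - t links
   the two. *)
- rewrite /eigenvalue /eigenspace kermx_eq0 row_free_unit; apply/negP => A_unit.
  move: mu_neq0; apply/negP/negPn.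
  pose v : 'cV[R[i]]_n := \col_i ((mu 0 i)%:C)%C.
  have Av : (map_mx (fun a : nat => a%:R : R[i]) M - (t%:C%C)%:M) *m v = 0.
    apply/colP => i; rewrite mulmxBl mul_scalar_mx !mxE.
    rewrite -rmorphM -(m_prop i).2 /mnm_weight rmorph_sum.
    apply/eqP; rewrite subr_eq0; apply/eqP; apply: eq_bigr => j _.
    by rewrite !mxE rmorphM rmorph_nat.
  have v0 : v = 0 by rewrite -(mulKmx A_unit v) Av mulmx0.
  by apply/eqP/rowP => i; move/colP/(_ i) : v0; rewrite !mxE => -[].
- by rewrite /ComplexField.Normc.normc /= expr0n addr0 sqrtr_sqr ger0_norm.
Qed.

Lemma normc_sum (I : Type) (r : seq I) (F : I -> R[i]) :
  ComplexField.Normc.normc (\sum_(i <- r) F i) <=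
  \sum_(i <- r) ComplexField.Normc.normc (F i).
Proof.
apply: (big_ind2 (fun x y => ComplexField.Normc.normc x <= y)) => //.
- by rewrite ComplexField.Normc.normc0.
- move=> x a y b xa yb; apply: le_trans (le_normcD x y) _; exact: lerD.
Qed.

Lemma normc_nat (a : nat) : ComplexField.Normc.normc (a%:R : R[i]) = a%:R.
Proof.
rewrite -(rmorph_nat (real_complex R)) /=.
by rewrite expr0n addr0 sqrtr_sqr ger0_norm.
Qed.

Lemma normc_ge0 (x : R[i]) : 0 <= ComplexField.Normc.normc x.
Proof. by case: x => a b; exact: sqrtr_ge0. Qed.

(* Pair |w M| with nu, where w is a left eigenvector of M. *)
Lemma eigen_moduli_le nu t : (forall i, 0 < nu 0 i) ->
  (forall i, weights_in nu [set u | u <= t * nu 0 i] (tnth f i)) ->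
  ubound (eigen_moduli f) t.
Proof.
move=> nu0 ft _ [M [xi [Mf /eigenvalueP[w wM w0] ->]]].
pose norm := @ComplexField.Normc.normc R.
pose S := \sum_i norm (w 0 i) * nu 0 i.
have S0 : 0 < S.
  have /rV0Pn[i wi] := w0.
  rewrite lt_def sumr_ge0 ?andbT => [|j _]; last by rewrite mulr_ge0 ?normc_ge0// ltW.
  rewrite psumr_neq0 => [|j _]; last by rewrite mulr_ge0 ?normc_ge0// ltW.
  apply/hasP; exists i; rewrite ?mem_index_enum//= mulr_gt0//.
  rewrite lt_def normc_ge0 andbT; apply: contra wi => /eqP.
  by move=> /ComplexField.Normc.eq0_normc ->.
rewrite -(ler_pM2r S0) /S !mulr_sumr.
apply: le_trans (_ : \sum_j \sum_i norm (w 0 i) * ((M i j)%:R * nu 0 j) <= _).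
  apply: ler_sum => j _; rewrite mulrA -ComplexField.Normc.normcM.
  have -> : xi * w 0 j = \sum_i w 0 i * (M i j)%:R.
    have /rowP/(_ j) := wM; rewrite !mxE => <-.
    by apply: eq_bigr => i _; rewrite mxE.
  apply: le_trans (ler_wpM2r (ltW (nu0 j)) (normc_sum _ _)) _.
  rewrite mulr_suml; apply: ler_sum => i _.
  by rewrite ComplexField.Normc.normcM normc_nat mulrA.
rewrite exchange_big; apply: ler_sum => i _ /=.
rewrite -mulr_sumr mulrCA ler_wpM2l ?normc_ge0//.
have := Mf i; rewrite -mcoeff_msupp => /ft; apply: le_trans.
by apply: ler_sum => j _; rewrite multinomE tnth_mktuple.
Qed.

(** [get] returns some maximum of the set, and a maximum is unique. *)
Lemma maximal_eigenvalue_eq t : eigen_moduli f t -> ubound (eigen_moduli f) t ->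
  maximal_eigenvalue R f = t.
Proof.
move=> tf t_ub; rewrite /maximal_eigenvalue.
have [sf s_ub] : [set t | eigen_moduli f t /\ ubound (eigen_moduli f) t]
    (maximal_eigenvalue R f).
  by apply: getPex; exists t.
by apply/eqP; rewrite eq_le s_ub// t_ub.
Qed.

Lemma maximal_eigenvalueP :
  let theta := maximal_eigenvalue R f in
  [/\ 0 <= theta, eigen_moduli f theta, exists mu : 'rV[R]_n, maximal_eigenvector f mu &
      forall t, theta < t -> exists nu, (forall i, 0 < nu 0 i) /\
        forall i, weights_in nu [set u | u <= t * nu 0 i] (tnth f i)].
Proof.
have [s [mu [s0 mu0 mu_neq0 mu_eigen nu_ex]]] :=
  perron_frobenius n_gt0 deg_map_mono deg_mapZ deg_map_continuous.
have mu_deg i : deg_mu mu (tnth f i) = (s * mu 0 i)%:E.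
  by rewrite deg_mu_deg_map// mu_eigen.
have nu_ex' t : s < t -> exists nu, (forall i, 0 < nu 0 i) /\
    forall i, weights_in nu [set u | u <= t * nu 0 i] (tnth f i).
  move=> st; have [nu [nu0 nut]] := nu_ex t st; exists nu; split=> // i.
  apply/weights_le_deg_map; last exact: nut.
  by rewrite mulr_ge0 ?(ltW (nu0 i))// ltW// (le_lt_trans s0).
have sf := eigen_moduli_of_eigenvector s0 mu_neq0 mu_deg.
have s_ub : ubound (eigen_moduli f) s.
  (* A positive nu is available only for parameters above s, so the bound is proved up to e. *)
  move=> x xf; apply/ler_addgt0Pr => e e0.
  have [|nu [nu0 nut]] := nu_ex' (s + e); first by rewrite ltrDl.
  exact: (eigen_moduli_le nu0 nut).
rewrite /= (maximal_eigenvalue_eq sf s_ub); split=> //.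
by exists mu; split=> // i; rewrite (maximal_eigenvalue_eq sf s_ub).
Qed.

End MaximalEigenvalue.

(** * Dynamical degree, algebraic stability and leading parts *)

Section DynamicalDegree.
Variables (R : realType) (k : fieldType) (n : nat) (f : endo k n).
Hypotheses (n_gt0 : (0 < n)%N) (f_dom : dominant f).
Implicit Types (mu : 'rV[R]_n).

Let lam : R := dynamical_degree R f.
Let theta : R := maximal_eigenvalue R f.

Let deg_fekete := fekete R (fun r => endo_deg_iter_gt0 r n_gt0 f_dom)
  (endo_deg_iterD R f).

Let f_neq0 i : tnth f i != 0. Proof. exact: dominant_neq0. Qed.

Lemma dynamical_degree_ge1 : 1 <= lam.
Proof. by have [] := deg_fekete. Qed.

(** Fekete gives lam^(r m) <= deg(f^(r m)), which is at most [distortion mu] times t^m since mu is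
    positive; comparing growth in m removes the constant. *)
Lemma dynamical_degree_le_iter mu (r : nat) (t : R) : (0 < r)%N -> 0 <= t ->
  (forall i, 0 < mu 0 i) ->
  (forall i, weights_in mu [set u | u <= t * mu 0 i] (tnth (endo_iter f r) i)) ->
  lam ^+ r <= t.
Proof.
move=> r0 t0 mu0 frt; have [lam1 lam_le _] := deg_fekete.
have lam0 : 0 <= lam := le_trans ler01 lam1.
apply: (le_of_expr_bound (c := distortion mu)) => // [|m]; first exact: exprn_ge0.
rewrite -exprM; apply: le_trans (lam_le _) _.
apply: endo_deg_le_distortion => //; first exact: exprn_ge0.
have -> : endo_iter f (r * m) = endo_iter (endo_iter f r) m.
  elim: m => [|m IH]; first by rewrite muln0.
  apply: eq_from_tnth => i; rewrite mulnS endo_iterD IH.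
  by rewrite endo_iter_comp.
by move=> i; exact: weights_le_iter.
Qed.

Lemma dynamical_degree_le_maximal_eigenvalue : lam <= theta.
Proof.
have [theta0 _ _ nu_ex] := maximal_eigenvalueP R n_gt0 f_neq0.
apply/ler_addgt0Pr => e e0.
have [|nu [nu0 fnu]] := nu_ex (theta + e); first by rewrite ltrDl.
rewrite -[lam]expr1; apply: (dynamical_degree_le_iter _ _ nu0) => //.
  by rewrite addr_ge0// ltW.
by move=> i; rewrite endo_iter1.
Qed.

Lemma maximal_eigenvalue_le_deg : theta <= (endo_deg f)%:R.
Proof.
have [_ theta_eigen _ _] := maximal_eigenvalueP R n_gt0 f_neq0.
apply: (eigen_moduli_le (nu := const_mx 1) _ _ theta_eigen) => i; first by rewrite mxE.
move=> m /mdeg_le_endo_deg mf.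
by rewrite /= mnm_weight1 mxE mulr1 ler_nat.
Qed.

Lemma maximal_eigenvalue_ge1 : 1 <= theta.
Proof. exact: le_trans dynamical_degree_ge1 dynamical_degree_le_maximal_eigenvalue. Qed.

Variable mu : 'rV[R]_n.
Hypothesis mu_max : maximal_eigenvector f mu.

Let theta_gt0 : 0 < theta.
Proof. exact: lt_le_trans ltr01 maximal_eigenvalue_ge1. Qed.

Let mu_ge0 i : 0 <= mu 0 i. Proof. by case: mu_max. Qed.

Let f_le i : weights_in mu [set u | u <= theta * mu 0 i] (tnth f i).
Proof. by apply/deg_mu_leP; case: mu_max => _ _ ->. Qed.

Let iter_le r i :
  weights_in mu [set u | u <= theta ^+ r * mu 0 i] (tnth (endo_iter f r) i).
Proof. by apply: weights_le_iter => //; exact: ltW. Qed.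

Lemma endo_deg_mu_maximal : endo_deg_mu mu f = theta%:E.
Proof.
apply/endo_deg_mu_eqP => //; have [_ mu_neq0 mu_deg] := mu_max.
have /rV0Pn[i mui] := mu_neq0; exists i; split; first by rewrite lt_def mui mu_ge0.
by have [] := (deg_mu_eqP _ _ _).1 (mu_deg i).
Qed.

(** The bound theta^r on the weighted degree of f^r always holds, so stability means that it is
    attained in a component of positive weight. *)
Lemma alg_stable_maximalP : alg_stable mu f <-> forall r, (1 <= r)%N ->
  exists i, 0 < mu 0 i /\
    ~ weights_in mu [set u | u < theta ^+ r * mu 0 i] (tnth (endo_iter f r) i).
Proof.
rewrite /alg_stable endo_deg_mu_maximal.
split=> [[_ stable] r r0|stable]; first last.
  split=> [|r r0]; first exact: ltry.
  rewrite -EFin_expe; apply/endo_deg_mu_eqP => //; first exact: exprn_gt0.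
  exact: stable.
apply: (endo_deg_mu_eqP (exprn_gt0 r theta_gt0) mu_ge0 (@iter_le r)).1.
by rewrite EFin_expe; exact: stable.
Qed.

(** Stability bounds theta^r by a constant times deg(f^r), which grows at most like (lam + e)^r. *)
Lemma alg_stable_dynamical_degree : alg_stable mu f -> lam = theta.
Proof.
move=> /alg_stable_maximalP stable; have [lam1 _ lam_ge] := deg_fekete.
apply/eqP; rewrite eq_le dynamical_degree_le_maximal_eigenvalue.
apply/ler_addgt0Pr => e e0.
have [|c Dc] := lam_ge (lam + e); first by rewrite ltrDl.
(* The 1 in the maximum covers r = 0, where stability says nothing. *)
apply: (le_of_expr_bound (c := Num.max 1 (distortion mu * c))).
- exact: ltW.
- by rewrite addr_ge0// ltW// (lt_le_trans ltr01).
have lame_ge0 : 0 <= lam + e by rewrite addr_ge0 ?(le_trans ler01 lam1)// ltW.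
move=> [|r]; first by rewrite !expr0 mulr1 le_max lexx.
have [//|i [mui nlt]] := stable r.+1.
apply: le_trans (le_distortion_endo_deg mu_ge0 mui nlt) _.
apply: le_trans (ler_wpM2l (distortion_ge0 mu_ge0) (Dc _)) _.
by rewrite mulrA ler_wpM2r ?exprn_ge0// le_max lexx orbT.
Qed.

(** If the weighted degree of f^r were below theta^r, a bound u < theta^r for f^r would give lam^r
    <= u. *)
Lemma dynamical_degree_alg_stable : lam = theta -> (forall i, 0 < mu 0 i) ->
  alg_stable mu f.
Proof.
move=> lam_theta mu0; rewrite /alg_stable endo_deg_mu_maximal.
split=> [|r r0]; first exact: ltry.
rewrite -EFin_expe; apply/eqP; rewrite eq_le endo_deg_mu_le//; last exact/ltW/exprn_gt0.
rewrite leNgt; apply/negP => /endo_deg_mu_lt[u /andP[u0 ut] fu].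
have := dynamical_degree_le_iter r0 u0 mu0 fu.
by rewrite lam_theta leNgt ut.
Qed.

(** A component of g^r is nonzero exactly when the same component of f^r attains the bound theta^r
    mu_i. *)
Lemma alg_stable_leading_part : alg_stable mu f <->
  forall r, (1 <= r)%N ->
    exists i, 0 < mu 0 i /\ tnth (endo_iter (leading_part mu f) r) i != 0.
Proof.
have lead j : is_part mu (theta * mu 0 j) (tnth f j) (tnth (leading_part mu f) j).
  by rewrite tnth_mktuple endo_deg_mu_maximal; exact: homog_part_is_part.
have lead_iter r i := is_part_neq0 (is_part_iter r i theta_gt0 lead).
rewrite alg_stable_maximalP.
by split=> stable r /stable[i [mui nz]]; exists i; split=> //; apply/lead_iter.
Qed.

End DynamicalDegree.

Theorem proposition2 (R : realType) (k : fieldType) (n : nat) (hn : (1 <= n)%N)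
    (f : endo k n) (hf : dominant f)
    (theta : R) (htheta : theta = maximal_eigenvalue R f) :
  (exists mu : 'rV[R]_n, maximal_eigenvector f mu) /\
  (1 <= dynamical_degree R f /\ dynamical_degree R f <= theta /\
     theta <= (endo_deg f)%:R) /\
  (forall mu : 'rV[R]_n, maximal_eigenvector f mu ->
     theta%:E = endo_deg_mu mu f /\
     (alg_stable mu f -> dynamical_degree R f = theta) /\
     (dynamical_degree R f = theta -> 1 < theta -> (forall i, 0 < mu 0 i) ->
        alg_stable mu f) /\
     (1 < theta ->
        (alg_stable mu f <->
         forall r : nat, (1 <= r)%N ->
           exists i : 'I_n,
             0 < mu 0 i /\ tnth (endo_iter (leading_part mu f) r) i != 0))).
Proof.
rewrite htheta; split.
  by have [] := maximal_eigenvalueP R hn (fun i => dominant_neq0 i hf).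
split.
  split; first exact: dynamical_degree_ge1.
  split; first exact: dynamical_degree_le_maximal_eigenvalue.
  exact: maximal_eigenvalue_le_deg.
move=> mu mu_max; split; first by rewrite (endo_deg_mu_maximal hn hf mu_max).
split; first exact: alg_stable_dynamical_degree.
split=> [lam_theta _|_]; first exact: dynamical_degree_alg_stable.
exact: alg_stable_leading_part.
Qed.
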